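(* Let $\Gamma$ be a finite graph which has a vertex of degree $|\Gamma|-3$ or less, but does not have both a vertex of degree $|\Gamma|-3$ and a vertex of degree $|\Gamma|-2$. Then there exists a graph $\Omega$ with $|\Omega| = |\Gamma|+1$ such that the graph group $G(\Gamma)$ embeds into the graph group $G(\Omega)$, but $\Gamma$ does not embed into $\Omega$.
   Context: A graph $\Gamma$ is a set $V(\Gamma)$ of vertices together with a reflexive, symmetric relation $E(\Gamma) \subseteq V(\Gamma) \times V(\Gamma)$; vertices $u,v$ are adjacent if $(u,v) \in E(\Gamma)$. $|\Gamma|$ denotes the number of vertices of $\Gamma$. The degree of a vertex is the number of vertices adjacent to and distinct from it. An embedding of graphs is a map on vertices which is injective and preserves both adjacency and non-adjacency. The graph group $G(\Gamma)$ is the group with presentation $\langle V(\Gamma) \mid ab = ba \text{ for all } (a,b) \in E(\Gamma) \rangle$. A group embeds into another if there is an injective group homomorphism from the first to the second. *)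

(* Defs.v *)
From HB Require Import structures.
From mathcomp Require Import all_boot.
From mathcomp Require Import boolp.

Set Implicit Arguments.
Unset Strict Implicit.
Unset Printing Implicit Defensive.

Local Open Scope group_scope.
Local Open Scope quotient_scope.

(* Adjacency is reflexive, so a vertex is adjacent to itself and is excluded
   explicitly from its own [degree]. *)
Record graph := Graph {
  vertex :> finType;
  adj : rel vertex;
  adj_refl : reflexive adj;
  adj_sym : symmetric adj
}.

Definition degree (Gamma : graph) (v : Gamma) : nat :=
  #|[set u : Gamma | adj v u & u != v]|.

Definition graph_embeds (Gamma Omega : graph) : Prop :=
  exists2 f : Gamma -> Omega,
    injective f & forall u v, adj (f u) (f v) = adj u v.

(* The letter [(x, false)] is the generator [x], and [(x, true)] its inverse. *)
Definition word (T : Type) : Type := seq (T * bool).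

Definition inv_word (T : Type) (w : word T) : word T :=
  rev [seq (a.1, ~~ a.2) | a <- w].

(* Equality of words in the group with generators [T], where [R u v] means that
   [u = v] is one of the defining relations. *)
Inductive pres_eq (T : Type) (R : word T -> word T -> Prop) :
    word T -> word T -> Prop :=
| pres_eq_rel u v : R u v -> pres_eq R u v
| pres_eq_cancel x b : pres_eq R [:: (x, b); (x, ~~ b)] [::]
| pres_eq_refl u : pres_eq R u u
| pres_eq_sym u v : pres_eq R u v -> pres_eq R v u
| pres_eq_trans v u w : pres_eq R u v -> pres_eq R v w -> pres_eq R u w
| pres_eq_cat u u' v v' :
    pres_eq R u u' -> pres_eq R v v' -> pres_eq R (u ++ v) (u' ++ v').

Section Presentation.
Context (T : choiceType) (R : word T -> word T -> Prop).

Definition pres_rel : rel (word T) := fun u v => `[< pres_eq R u v >].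

Fact pres_rel_refl : reflexive pres_rel.
Proof. by move=> u; apply/asboolP/pres_eq_refl. Qed.

Fact pres_rel_sym : symmetric pres_rel.
Proof. by move=> u v; apply/asboolP/asboolP => /pres_eq_sym. Qed.

Fact pres_rel_trans : transitive pres_rel.
Proof.
by move=> v u w /asboolP uv /asboolP vw; apply/asboolP/(pres_eq_trans uv vw).
Qed.

Canonical pres_equiv := EquivRel pres_rel pres_rel_refl pres_rel_sym pres_rel_trans.

Definition pres_group : Type := {eq_quot pres_equiv}.
HB.instance Definition _ := Choice.on pres_group.
HB.instance Definition _ := EqQuotient.on pres_group.

Lemma pres_groupP (u v : word T) :
  \pi_pres_group u = \pi_pres_group v <-> pres_eq R u v.
Proof. by split=> [/eqmodP/asboolP|uv] //; apply/eqmodP/asboolP. Qed.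

Lemma pres_eq_repr (u : word T) : pres_eq R (repr (\pi_pres_group u)) u.
Proof. by apply/pres_groupP; rewrite reprK. Qed.

Lemma inv_word_cat (u v : word T) : inv_word (u ++ v) = inv_word v ++ inv_word u.
Proof. by rewrite /inv_word map_cat rev_cat. Qed.

Lemma inv_wordK : involutive (@inv_word T).
Proof.
move=> u; rewrite /inv_word map_rev revK -map_comp map_id_in // => -[x b] _ /=.
by rewrite negbK.
Qed.

Lemma pres_eq_mulV (u : word T) : pres_eq R (u ++ inv_word u) [::].
Proof.
elim: u => [|[x b] u IHu]; first exact: pres_eq_refl.
rewrite -cat1s inv_word_cat -catA.
apply: pres_eq_trans (pres_eq_cancel R x b).
apply: (pres_eq_cat (pres_eq_refl R [:: (x, b)])); rewrite catA.
exact: (pres_eq_cat IHu (pres_eq_refl R [:: (x, ~~ b)])).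
Qed.

Lemma pres_eq_mulN (u : word T) : pres_eq R (inv_word u ++ u) [::].
Proof. by rewrite -{2}[u]inv_wordK; apply: pres_eq_mulV. Qed.

Lemma pres_eq_inv (u v : word T) :
  pres_eq R u v -> pres_eq R (inv_word u) (inv_word v).
Proof.
move=> uv; have r w := pres_eq_refl R w.
rewrite -[X in pres_eq R X]cats0 -[X in pres_eq R _ X]cat0s.
apply: pres_eq_trans (pres_eq_cat (pres_eq_mulN u) (r (inv_word v))).
rewrite -catA; apply: pres_eq_cat (r _) _; apply: pres_eq_sym.
apply: pres_eq_trans (pres_eq_mulV v).
exact: pres_eq_cat uv (r _).
Qed.

Definition pres_mul (g h : pres_group) : pres_group :=
  \pi_pres_group (repr g ++ repr h).
Definition pres_one : pres_group := \pi_pres_group [::].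
Definition pres_inv (g : pres_group) : pres_group :=
  \pi_pres_group (inv_word (repr g)).

Lemma pi_pres_mul (u v : word T) :
  \pi_pres_group (u ++ v) = pres_mul (\pi u) (\pi v).
Proof.
by apply/pres_groupP/pres_eq_sym/pres_eq_cat; apply: pres_eq_repr.
Qed.

Lemma pi_pres_inv (u : word T) :
  \pi_pres_group (inv_word u) = pres_inv (\pi u).
Proof. by apply/pres_groupP/pres_eq_sym/pres_eq_inv/pres_eq_repr. Qed.

Fact pres_mulA : associative pres_mul.
Proof.
move=> g h k; rewrite -[g]reprK -[h]reprK -[k]reprK.
by rewrite -!pi_pres_mul catA.
Qed.

Fact pres_mul1g : left_id pres_one pres_mul.
Proof. by move=> g; rewrite -[g]reprK -pi_pres_mul. Qed.

Fact pres_mulg1 : right_id pres_one pres_mul.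
Proof. by move=> g; rewrite -[g]reprK -pi_pres_mul cats0. Qed.

Fact pres_mulVg : left_inverse pres_one pres_inv pres_mul.
Proof.
move=> g; rewrite -[g]reprK -pi_pres_inv -pi_pres_mul.
exact/pres_groupP/pres_eq_mulN.
Qed.

Fact pres_mulgV : right_inverse pres_one pres_inv pres_mul.
Proof.
move=> g; rewrite -[g]reprK -pi_pres_inv -pi_pres_mul.
exact/pres_groupP/pres_eq_mulV.
Qed.

HB.instance Definition _ := isGroup.Build pres_group
  pres_mulA pres_mul1g pres_mulg1 pres_mulVg pres_mulgV.

Definition pres_gen (x : T) : pres_group := \pi_pres_group [:: (x, false)].

End Presentation.

(* The two parts of the universal property: a map to a group which respects the
   defining relations extends to a homomorphism, and the extension is unique. *)
Section Universal.
Context (T : choiceType) (R : word T -> word T -> Prop).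
Context (H : groupType) (f : T -> H).

Fixpoint eval_word (w : word T) : H :=
  if w is (x, b) :: w' then (if b then (f x)^-1 else f x) * eval_word w' else 1.

Lemma eval_word_cat (u v : word T) :
  eval_word (u ++ v) = eval_word u * eval_word v.
Proof. by elim: u => [|[x b] u IHu] /=; rewrite ?mul1g // IHu mulgA. Qed.

Lemma pres_group_ext :
  (forall u v, R u v -> eval_word u = eval_word v) ->
  exists F : {multiplicative pres_group R -> H},
    forall x, F (pres_gen R x) = f x.
Proof.
move=> Rf.
have evalP u v : pres_eq R u v -> eval_word u = eval_word v.
  elim=> {u v} [u v /Rf //|x [] /=|//|u v _ -> //|v u w _ -> _ -> //|].
  - by rewrite mulg1 mulVg.
  - by rewrite mulg1 mulgV.
  - by move=> u u' v v' _ uu' _ vv'; rewrite !eval_word_cat uu' vv'.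
pose F (g : pres_group R) := eval_word (repr g).
have FE u : F (\pi_(pres_group R) u) = eval_word u.
  exact/evalP/pres_eq_repr.
have FM : {morph F : g h / g * h}.
  by move=> g h; rewrite [LHS]FE eval_word_cat.
pose F' := HB.pack_for {multiplicative pres_group R -> H} F
  (isMultiplicative.Build _ _ F FM).
by exists F' => x; rewrite [LHS]FE /= mulg1.
Qed.

Lemma pres_group_ext_unique (F G : {multiplicative pres_group R -> H}) :
  (forall x, F (pres_gen R x) = G (pres_gen R x)) -> F =1 G.
Proof.
have morph1 (K : {multiplicative pres_group R -> H}) : K 1 = 1.
  by apply: (mulgI (K 1)); rewrite -gmulfM !mulg1.
have morphV (K : {multiplicative pres_group R -> H}) g : K g^-1 = (K g)^-1.
  by apply: (mulgI (K g)); rewrite -gmulfM !mulgV morph1.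
move=> FG g; rewrite -[g]reprK; elim: (repr g) => [|[x b] w IHw].
  by rewrite [\pi _](_ : _ = 1) // !morph1.
have -> : \pi_(pres_group R) ((x, b) :: w) =
    (if b then (pres_gen R x)^-1 else pres_gen R x) * \pi_(pres_group R) w.
  rewrite -cat1s pi_pres_mul; congr (_ * _).
  by case: b => //; rewrite [RHS](esym (pi_pres_inv _ _)).
by rewrite !gmulfM IHw; case: b; rewrite ?morphV FG.
Qed.

End Universal.

(* One relation [ab = ba] for each adjacent pair; [adj] being reflexive, this
   includes the trivial [aa = aa]. *)
Inductive commutation (Gamma : graph) : word Gamma -> word Gamma -> Prop :=
| Commutation (a b : Gamma) : adj a b ->
    commutation [:: (a, false); (b, false)] [:: (b, false); (a, false)].

Definition graph_group (Gamma : graph) : groupType :=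
  pres_group (@commutation Gamma).

(* A multiplicative map between groups preserves [1] and inverses. *)
Definition group_embeds (G H : groupType) : Prop :=
  exists f : {multiplicative G -> H}, injective f.

(* Main.v *)
From HB Require Import structures.
Require Import Defs.
From mathcomp Require Import all_boot zify.

Set Implicit Arguments.
Unset Strict Implicit.
Unset Printing Implicit Defensive.

(* We work with codegrees, the degrees in the complement graph.  Split a vertex
   [v] into two non-adjacent vertices [a] and [b], sharing out the non-neighbours
   of [v] between them, possibly with overlap.  Then [v |-> b^-1 a b] embeds the
   graph group of [Gamma] into that of the split graph [Omega]: mapping [b] to the
   swap, [a] to [(1, v)], a neighbour [u] of [b] to [(u, u)] and any other [u] to
   [(u, 1)] defines a homomorphism to the wreath product of the graph group of
   [Gamma] with Z/2, and the composite is the identity in the first coordinate.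

   Counting non-adjacent pairs, a vertex of [Omega] missed by an embedding of
   [Gamma] has codegree one more than the size of the overlap.  If [Gamma] has no
   vertex of codegree 1, an empty overlap leaves no such vertex.  If [Gamma] has no
   vertex of codegree 2, take [v] of codegree at least 3, give [a] two
   non-neighbours and let one of them, [u], be the overlap: only [u] can be missed,
   but removing it would leave [a] with codegree 2. *)

(** * The wreath product with Z/2 *)

Section Wreath.
Local Open Scope group_scope.
Variable K : groupType.

Definition wreath2 : Type := (K * K * bool)%type.
HB.instance Definition _ := Choice.on wreath2.

(** The Boolean is the swap: that of the left factor exchanges the coordinates of the right one. *)
Definition wreath2_mul (g h : wreath2) : wreath2 :=
  let: (x, y, s) := g in let: (x', y', t) := h in
  if s then (x * y', y * x', ~~ t) else (x * x', y * y', t).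
Definition wreath2_one : wreath2 := (1, 1, false).
Definition wreath2_inv (g : wreath2) : wreath2 :=
  let: (x, y, s) := g in
  if s then (y^-1, x^-1, true) else (x^-1, y^-1, false).

Fact wreath2_mulA : associative wreath2_mul.
Proof. by move=> [[? ?] []] [[? ?] []] [[? ?] []] /=; rewrite !mulgA. Qed.

Fact wreath2_mul1g : left_id wreath2_one wreath2_mul.
Proof. by move=> [[? ?] ?]; rewrite /= !mul1g. Qed.

Fact wreath2_mulg1 : right_id wreath2_one wreath2_mul.
Proof. by move=> [[? ?] []]; rewrite /= !mulg1. Qed.

Fact wreath2_mulVg : left_inverse wreath2_one wreath2_inv wreath2_mul.
Proof. by move=> [[? ?] []]; rewrite /= !mulVg. Qed.

Fact wreath2_mulgV : right_inverse wreath2_one wreath2_inv wreath2_mul.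
Proof. by move=> [[? ?] []]; rewrite /= !mulgV. Qed.

HB.instance Definition _ := isGroup.Build wreath2
  wreath2_mulA wreath2_mul1g wreath2_mulg1 wreath2_mulVg wreath2_mulgV.

Lemma wreath2_mulE (g h : wreath2) : g * h = wreath2_mul g h.
Proof. by []. Qed.

Lemma wreath2_invE (g : wreath2) : g^-1 = wreath2_inv g.
Proof. by []. Qed.

End Wreath.

Section Multiplicative.
Local Open Scope group_scope.
Variables (G H : groupType) (f : {multiplicative G -> H}).

Lemma multiplicative1 : f 1 = 1.
Proof. by apply: (mulgI (f 1)); rewrite -gmulfM !mulg1. Qed.

Lemma multiplicativeV g : f g^-1 = (f g)^-1.
Proof. by apply: (mulgI (f g)); rewrite -gmulfM !mulgV multiplicative1. Qed.

End Multiplicative.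

(** * Generators and homomorphisms of graph groups *)

Section GraphGroup.
Local Open Scope group_scope.
Local Open Scope quotient_scope.

Definition graph_gen (Gamma : graph) (u : Gamma) : graph_group Gamma :=
  pres_gen (@commutation Gamma) u.

Lemma graph_gen_commute (Gamma : graph) (u v : Gamma) :
  adj u v -> graph_gen u * graph_gen v = graph_gen v * graph_gen u.
Proof.
move=> uv; rewrite -[LHS]pi_pres_mul -[RHS]pi_pres_mul.
exact/pres_groupP/pres_eq_rel/Commutation.
Qed.

Lemma graph_group_ind (Gamma : graph) (P : graph_group Gamma -> Prop) :
    P 1 -> (forall u g, P g -> P (graph_gen u * g)) ->
    (forall u g, P g -> P ((graph_gen u)^-1 * g)) ->
  forall g, P g.
Proof.
move=> P1 PM PV g; rewrite -[g]reprK.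
elim: (repr g) => [|[u s] w IHw]; first exact: P1.
rewrite -cat1s pi_pres_mul; case: s; last exact: PM.
have -> : \pi_(pres_group (@commutation Gamma)) [:: (u, true)] = (graph_gen u)^-1.
  by rewrite [RHS](esym (pi_pres_inv _ _)).
exact: PV.
Qed.

Lemma graph_group_ext (Gamma : graph) (H : groupType) (f : Gamma -> H) :
  (forall u v, adj u v -> f u * f v = f v * f u) ->
  exists F : {multiplicative graph_group Gamma -> H},
    forall u, F (graph_gen u) = f u.
Proof.
by move=> fC; apply: pres_group_ext => _ _ [a b ab] /=; rewrite !mulg1 fC.
Qed.

End GraphGroup.

(** * Codegrees and the vertex missed by an embedding *)

Section Codegree.

Definition codegree (Gamma : graph) (v : Gamma) : nat :=
  \sum_(u : Gamma) ~~ adj v u.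

Lemma card_nonadj (Gamma : graph) (v : Gamma) :
  #|[set u | ~~ adj v u]| = codegree v.
Proof. by rewrite cardsE -sum1_card big_mkcond. Qed.

Lemma degree_codegree (Gamma : graph) (v : Gamma) :
  degree v + codegree v + 1 = #|Gamma|.
Proof.
rewrite -(cardsC [set u | adj v u]) (cardsD1 v [set u | adj v u]) inE adj_refl.
rewrite -card_nonadj addnC addnA; congr (_ + _ + _); apply: eq_card => u.
  by rewrite !inE andbC.
by rewrite !inE.
Qed.

Variables (Gamma Omega : graph) (f : Gamma -> Omega).
Hypotheses (f_inj : injective f) (f_adj : forall u v, adj (f u) (f v) = adj u v).
Hypothesis card_Omega : #|Omega| = #|Gamma|.+1.

Lemma missed_vertex : exists w : Omega,
  (forall y, y != w -> exists x, y = f x) /\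
  (forall F : Omega -> nat, \sum_y F y = F w + \sum_x F (f x)).
Proof.
have : #|~: (f @: [set: Gamma])| = 1.
  by rewrite cardsCs setCK card_imset // cardsT card_Omega subSnn.
move=> /eqP/cards1P[w fCw]; exists w.
have f_w y : (y != w) = (y \in f @: [set: Gamma]).
  by rewrite -in_set1 -fCw inE negbK.
split=> [y|F]; first by rewrite f_w => /imsetP[x _ ->]; exists x.
rewrite (bigD1 w) //=; congr (_ + _).
rewrite (eq_bigl _ _ f_w) big_imset /=; last by move=> ? ? _ _; apply: f_inj.
by apply: eq_bigl => x; rewrite inE.
Qed.

(** Beyond the image, the only new non-adjacent pairs are those at [w], each counted once from
    either end. *)
Lemma codegree_missed : exists w : Omega,
  [/\ forall y, y != w -> exists x, y = f x,
      forall x, codegree (f x) = ~~ adj (f x) w + codegree x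
    & \sum_(y : Omega) codegree y = (codegree w).*2 + \sum_(x : Gamma) codegree x].
Proof.
have [w [fw sumw]] := missed_vertex.
have codeg_f x : codegree (f x) = ~~ adj (f x) w + codegree x.
  by rewrite /codegree sumw; congr (_ + _); apply: eq_bigr => y _; rewrite f_adj.
exists w; split=> //.
rewrite sumw (eq_bigr _ (fun x _ => codeg_f x)) big_split /= addnA -addnn.
congr (_ + _ + _).
rewrite [in RHS]/codegree sumw adj_refl.
by apply: eq_bigr => x _; rewrite adj_sym.
Qed.

End Codegree.

Lemma big_option (T : finType) (F : option T -> nat) :
  \sum_x F x = F None + \sum_x F (Some x).
Proof.
rewrite (bigD1 None) //=; congr (_ + _).
rewrite (reindex_omap Some id) //=; last by case.
by apply: eq_bigl => x; rewrite eqxx.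
Qed.

(** * The split graph, its group and its codegrees *)

Section Split.
Variables (Gamma : graph) (v : Gamma) (A B : {set Gamma}).

(* [Some v] and [None] are the two halves of [v]; [A] and [B] are the sets of
   their non-neighbours among the old vertices. *)
Definition split_adj (x y : option Gamma) : bool :=
  match x, y with
  | None, None => true
  | None, Some y => (y != v) && (y \notin B)
  | Some x, None => (x != v) && (x \notin B)
  | Some x, Some y =>
      if x == v then (y == v) || (y \notin A)
      else if y == v then x \notin A else adj x y
  end.

Fact split_adj_refl : reflexive split_adj.
Proof. by case=> [x|] //=; case: eqP => //= _; apply: adj_refl. Qed.

Fact split_adj_sym : symmetric split_adj.
Proof.
case=> [x|] [y|] //=.
by case: (x == v); case: (y == v) => //=; apply: adj_sym.
Qed.

Definition split : graph := Graph split_adj_refl split_adj_sym.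

Hypothesis AB : A :|: B = [set y | ~~ adj v y].

Lemma split_adjE y : adj v y = (y \notin A) && (y \notin B).
Proof. by rewrite -negb_or -in_setU AB inE negbK. Qed.

Section Embedding.
Local Open Scope group_scope.
Notation K := (graph_group Gamma).

Let a : graph_group split := graph_gen (Some v : split).
Let b : graph_group split := graph_gen (None : split).

Let emb (u : Gamma) : graph_group split :=
  if u == v then b^-1 * a * b else graph_gen (Some u : split).

(** A neighbour of [v] other than [v] lies in neither [A] nor [B], so it commutes with both [a] and
    [b]. *)
Let emb_comm u w : adj u w -> emb u * emb w = emb w * emb u.
Proof.
have comm_v x : x != v -> adj v x -> emb v * emb x = emb x * emb v.
  move=> xv; rewrite split_adjE => /andP[xA xB].
  have xa : commute (graph_gen (Some x : split)) a.
    by apply: graph_gen_commute; rewrite /= (negPf xv) eqxx.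
  have xb : commute (graph_gen (Some x : split)) b.
    by apply: graph_gen_commute; rewrite /= xv.
  rewrite /emb eqxx (negPf xv); apply/commute_sym.
  exact: commuteM (commuteM (commuteV xb) xa) xb.
have [-> | uv] := eqVneq u v.
  by have [-> // | wv] := eqVneq w v; apply: comm_v.
have [-> | wv] := eqVneq w v; first by rewrite adj_sym => /(comm_v _ uv).
move=> uw; rewrite /emb (negPf uv) (negPf wv).
by apply: graph_gen_commute; rewrite /= (negPf uv) (negPf wv).
Qed.

Let ret (x : option Gamma) : wreath2 K :=
  if x is Some u then
    if u == v then (1, graph_gen v, false)
    else (graph_gen u, if u \in B then 1 else graph_gen u, false)
  else (1, 1, true).

Let ret_comm (x y : split) : adj x y -> ret x * ret y = ret y * ret x.
Proof.
have comm_v u : u != v -> u \notin A ->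
    ret (Some v) * ret (Some u) = ret (Some u) * ret (Some v).
  rewrite /= eqxx => /negPf-> uA; rewrite !wreath2_mulE /= mul1g mulg1.
  (* For [u] in [B] the second coordinate of [ret (Some u)] is trivial; otherwise [u] is a neighbour
     of [v]. *)
  case: ifP => uB; first by rewrite mul1g mulg1.
  by rewrite graph_gen_commute // split_adjE uA uB.
have comm_b u : u != v -> u \notin B ->
    ret (Some u) * ret None = ret None * ret (Some u).
  (* Here [u] is sent to the diagonal, which the swap fixes. *)
  move=> /= /negPf-> /negPf->.
  by rewrite !wreath2_mulE /= !mul1g !mulg1.
case: x y => [x|] [y|] //; last 2 first; rewrite [adj _ _]/=.
- by case/andP; apply: comm_b.
- by case/andP=> yv yB; apply/esym/comm_b.
have [-> | xv] := eqVneq x v.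
  by have [-> // | yv] := eqVneq y v; apply: comm_v.
have [-> xA | yv xy] := eqVneq y v; first exact/esym/comm_v.
rewrite /= (negPf xv) (negPf yv) !wreath2_mulE /= (graph_gen_commute xy).
by do 2!case: ifP => _; rewrite ?mul1g ?mulg1 // (graph_gen_commute xy).
Qed.

Lemma split_group_embeds : group_embeds (graph_group Gamma) (graph_group split).
Proof.
have [F FE] := graph_group_ext emb_comm.
have [G GE] := graph_group_ext ret_comm.
(* Conjugation by the swap carries [v] from the second coordinate to the first. *)
have GF_v : G (b^-1 * a * b) = (graph_gen v, 1, false).
  rewrite !gmulfM multiplicativeV !GE /= eqxx wreath2_invE !wreath2_mulE /=.
  by rewrite !invg1 !mul1g !mulg1.
have GF_gen u : exists y, G (F (graph_gen u)) = (graph_gen u, y, false).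
  rewrite FE /emb; have [->|uv] := eqVneq u v; first by exists 1.
  by rewrite GE /= (negPf uv); eexists.
have GF g : exists y, G (F g) = (g, y, false).
  elim/graph_group_ind: g => [|u g [y GFg]|u g [y GFg]].
  - by exists 1; rewrite !multiplicative1.
  - have [z GFu] := GF_gen u.
    by exists (z * y); rewrite !gmulfM GFg GFu.
  - have [z GFu] := GF_gen u.
    by exists (z^-1 * y); rewrite !gmulfM !multiplicativeV GFg GFu.
exists F => g h Fgh; have [[y GFg] [z GFh]] := (GF g, GF h).
by move: GFg; rewrite Fgh GFh => -[->].
Qed.

End Embedding.

Lemma split_v_notin : (v \notin A) && (v \notin B).
Proof. by rewrite -split_adjE adj_refl. Qed.

(** The extra one is the other half, [None]. *)
Lemma codegree_split_v : codegree (Some v : split) = #|A|.+1.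
Proof.
rewrite /codegree big_option /= !eqxx add1n -sum1_card [in RHS]big_mkcond; congr _.+1.
apply: eq_bigr => x _; have [->|_] := eqVneq x v; last by case: (x \in A).
by case/andP: split_v_notin => /negPf->.
Qed.

Lemma codegree_split_None : codegree (None : split) = #|B|.+1.
Proof.
rewrite /codegree big_option /= (bigD1 v) //= eqxx add1n.
congr _.+1; rewrite -sum1_card [RHS]big_mkcond [RHS](bigD1 v) //=.
have /andP[_ /negPf->] := split_v_notin; rewrite add0n.
by apply: eq_bigr => x ->; case: (x \in B).
Qed.

(** A non-neighbour of [v] trades [v] for the halves it is assigned to, so only the overlap gains
    one. *)
Lemma codegree_split_Some y : y != v ->
  codegree (Some y : split) = codegree y + (y \in A :&: B).
Proof.
move=> yv; rewrite /codegree big_option /= yv (negPf yv) /= negbK.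
rewrite (bigD1 v) //= [X in _ = X + _](bigD1 v) //= eqxx negbK.
rewrite [X in _ + (_ + X)](eq_bigr (fun x => ~~ adj y x : nat)) => [|x /negPf->//].
rewrite [adj y v]adj_sym split_adjE inE.
by case: (y \in A); case: (y \in B) => /=; lia.
Qed.

(** The new non-adjacent pairs are the two halves and one pair per vertex of the overlap. *)
Lemma sum_codegree_split :
  \sum_(y : split) codegree y
    = (#|A :&: B|.+1).*2 + \sum_(x : Gamma) codegree x.
Proof.
rewrite big_option codegree_split_None (bigD1 v) //= codegree_split_v.
rewrite (eq_bigr _ codegree_split_Some) big_split /= [in RHS](bigD1 v) //=.
have -> : codegree v = #|A| + #|B| - #|A :&: B|.
  by rewrite -card_nonadj -AB cardsU.
have -> : \sum_(x | x != v) (x \in A :&: B) = #|A :&: B|.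
  rewrite -[RHS]sum1_card [RHS]big_mkcond [RHS](bigD1 v) //= inE.
  have /andP[/negPf-> _] := split_v_notin.
  by apply: eq_bigr => x _; case: (x \in _).
have : #|A :&: B| <= #|A| + #|B|.
  exact: leq_trans (subset_leq_card (subsetIl A B)) (leq_addr _ _).
lia.
Qed.

Lemma card_split : #|split| = #|Gamma|.+1.
Proof. exact: card_option. Qed.

End Split.

(** * Choosing the split *)

Theorem theorem21 (Gamma : graph)
    (hlow : exists v : Gamma, (degree v + 3 <= #|Gamma|)%N)
    (hnot : ~ ((exists v : Gamma, (degree v + 3)%N = #|Gamma|) /\
               (exists v : Gamma, (degree v + 2)%N = #|Gamma|))) :
  exists Omega : graph,
    [/\ #|Omega| = #|Gamma|.+1,
        group_embeds (graph_group Gamma) (graph_group Omega) &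
        ~ graph_embeds Gamma Omega].
Proof.
have degE (x : Gamma) k : degree x + k.+1 = #|Gamma| <-> codegree x = k.
  by have := degree_codegree x; lia.
have [v v_low] := hlow.
have v_ge2 : 2 <= codegree v by have := degree_codegree v; lia.
set N := [set y | ~~ adj v y]; have cardN : #|N| = codegree v := card_nonadj v.
have vN : v \notin N by rewrite inE adj_refl.
have [x xN] : exists x, x \in N by apply/card_gt0P; lia.
have cardNx : #|N :\ x|.+1 = codegree v by rewrite -cardN (cardsD1 x N) xN.
have [u uNx] : exists u, u \in N :\ x by apply/card_gt0P; lia.
have [ux uN] := setD1P uNx.
have uv : u != v by apply: contraNneq vN => <-.
(* The half [None] always gets all non-neighbours but [x], so [Some v] must take [x]; adding [u]
   creates the overlap. *)
have split_ok A : A :|: N :\ x = N -> ~ graph_embeds Gamma (split v A (N :\ x)) ->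
  exists Omega : graph, [/\ #|Omega| = #|Gamma|.+1,
    group_embeds (graph_group Gamma) (graph_group Omega) & ~ graph_embeds Gamma Omega].
  move=> AN nemb; exists (split v A (N :\ x)); split=> //; first exact: card_split.
  exact: split_group_embeds.
have [/existsP[l /eqP codeg_l]|no1] := boolP [exists l : Gamma, codegree l == 1]; last first.
  have AN : [set x] :|: N :\ x = N by exact: setD1K.
  apply: (split_ok [set x]) => // -[f f_inj f_adj].
  have [w [_ _]] := codegree_missed f_inj f_adj (card_split _ _ _).
  rewrite (sum_codegree_split AN).
  have -> : [set x] :&: (N :\ x) = set0.
    by apply/setP => y; rewrite !inE; case: eqP.
  (* Comparing codegree sums gives [codegree w = 1], but both halves have codegree at least 2. *)
  rewrite cards0 => /addIn/double_inj/esym.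
  case: w => [w|]; last by rewrite (codegree_split_None AN); lia.
  have [->|wv] := eqVneq w v; first by rewrite (codegree_split_v AN) cards1.
  rewrite (codegree_split_Some AN wv) => codeg_w.
  case/existsP: no1; exists w; apply/eqP; move: codeg_w.
  by rewrite !inE; case: eqP => //= _; rewrite addn0.
have no2 (y : Gamma) : codegree y <> 2.
  move=> codeg_y; apply: hnot; split; [exists y|exists l]; exact/degE.
have AN : [set u; x] :|: N :\ x = N.
  apply/setP => y; rewrite !inE; have [->|yx] := eqVneq y x.
    by rewrite orbT; move: xN; rewrite inE => ->.
  by have [->|//] := eqVneq y u; move: uN; rewrite inE => ->.
apply: (split_ok [set u; x]) => // -[f f_inj f_adj].
have [w [f_onto codeg_f]] := codegree_missed f_inj f_adj (card_split _ _ _).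
rewrite (sum_codegree_split AN).
have AB : [set u; x] :&: (N :\ x) = [set u].
  apply/setP => y; rewrite !inE; have [->|yx] := eqVneq y x.
    by rewrite andbF eq_sym (negPf ux).
  by rewrite orbF /=; have [->|//] := eqVneq y u; move: uN; rewrite inE => ->.
have codeg_v : codegree v <> 2 := no2 v.
(* Now [codegree w = 2], while [None] has the codegree of [v], which is not 2. *)
rewrite AB cards1 => /addIn/double_inj/esym.
have codeg_a : codegree (Some v : split v [set u; x] (N :\ x)) = 3.
  by rewrite (codegree_split_v AN) cards2 ux.
case: w f_onto codeg_f => [w|] f_onto codeg_f; last first.
  by rewrite (codegree_split_None AN); lia.
have [->|wv] := eqVneq w v; first by rewrite codeg_a.
rewrite (codegree_split_Some AN wv) AB inE.
have [wu _|_] := eqVneq w u; last by rewrite addn0 => /no2.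
(* As [u] is missed, [Some v] is some [f y]; of its codegree 3, one comes from [u], leaving
   [codegree y = 2]. *)
have [y ay] : exists y, Some v = f y.
  by apply: f_onto; rewrite (inj_eq Some_inj) eq_sym.
have := codeg_f y; rewrite -ay codeg_a /= eqxx wu (negPf uv) !inE eqxx /=.
by move=> [/esym/no2].
Qed.
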